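(* The Jacobi sequence of $e^2$ (where $e$ is Euler's number) is purely periodic, and its smallest period length is $40$.
   Context: For $x\in\mathbb{R}\setminus\mathbb{Q}$ with regular continued fraction expansion $x=[a_0,a_1,a_2,\ldots]$, the convergents $s_k/t_k$ are defined by $s_{-1}=1$, $s_0=a_0$, $s_k=a_ks_{k-1}+s_{k-2}$ and $t_{-1}=0$, $t_0=1$, $t_k=a_kt_{k-1}+t_{k-2}$ for $k\ge1$. For an odd natural number $n$ and an integer $m$ coprime to $n$, $\left(\frac{m}{n}\right)$ is the usual Jacobi symbol (equal to $1$ if $n=1$); if $n$ is even and $\gcd(m,n)=1$, one sets $\left(\frac{m}{n}\right)=*$, a fixed symbol different from $\pm1$. The Jacobi sequence of $x$ is $c_k=\left(\frac{s_k}{t_k}\right)$, $k\ge 0$. It is purely periodic with period length $L\ge1$ if $c_{k+L}=c_k$ for all $k\ge0$; the smallest period length is the least such $L$. *)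

(* Defs.v *)
From HB Require Import structures.
From mathcomp Require Import all_boot all_order all_algebra.
From mathcomp Require Import reals sequences.
Set Implicit Arguments. Unset Strict Implicit. Unset Printing Implicit Defensive.
Import Order.TTheory GRing.Theory Num.Theory.
Local Open Scope ring_scope.

(** Regular continued fraction of a real x (intended: x irrational).
    cf_rest x k is the k-th complete quotient x_k (x_0 = x,
    x_{k+1} = 1/(x_k - floor x_k)); the partial quotients are a_k = floor x_k. *)
Fixpoint cf_rest {R : realType} (x : R) (k : nat) : R :=
  match k with
  | 0 => x
  | k'.+1 => (cf_rest x k' - (Num.floor (cf_rest x k'))%:~R)^-1
  end.

Definition cf_a {R : realType} (x : R) (k : nat) : int := Num.floor (cf_rest x k).

(** cf_st x k = ((s_k, t_k), (s_{k-1}, t_{k-1})), with s_{-1}=1, t_{-1}=0,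
    s_0 = a_0, t_0 = 1, s_k = a_k s_{k-1} + s_{k-2}, t_k = a_k t_{k-1} + t_{k-2}. *)
Fixpoint cf_st {R : realType} (x : R) (k : nat) : (int * int) * (int * int) :=
  match k with
  | 0 => ((cf_a x 0, 1), (1, 0))
  | k'.+1 =>
      let '((s, t), (s', t')) := cf_st x k' in
      let a := cf_a x k'.+1 in
      ((a * s + s', a * t + t'), (s, t))
  end.

Definition cf_s {R : realType} (x : R) (k : nat) : int := (cf_st x k).1.1.
Definition cf_t {R : realType} (x : R) (k : nat) : int := (cf_st x k).1.2.

Definition legendre (m : int) (p : nat) : int :=
  let r := `|(m %% (p%:Z))%Z|%N in
  if r == 0%N then 0
  else if [exists x : 'I_p, (x * x %% p == r)%N] then 1 else -1.

(** Values of the (extended) Jacobi symbol: an integer (±1), or the extra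
    symbol * used for even denominators. *)
Inductive jval := JInt of int | JStar.

Definition jacobi (m : int) (n : nat) : jval :=
  if odd n then JInt (\prod_(p <- primes n) legendre m p ^+ logn p n)
  else JStar.

Definition jacobi_seq {R : realType} (x : R) (k : nat) : jval :=
  jacobi (cf_s x k) `|cf_t x k|%N.

Definition purely_periodic {T : Type} (c : nat -> T) (L : nat) : Prop :=
  (0 < L)%N /\ forall k, c (k + L)%N = c k.

Definition smallest_period {T : Type} (c : nat -> T) (L : nat) : Prop :=
  purely_periodic c L /\ forall L', purely_periodic c L' -> (L <= L')%N.

(* Main.v *)
(** The determinant identity [s_k t_{k-1} - s_{k-1} t_k = (-1)^{k+1}] turns
    [(s_k/t_k)] into [(t_{k-1}/t_k)] up to the sign [(-1/t_k)^{k+1}].  By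
    quadratic reciprocity the symbols of consecutive denominators, read as
    [(t_k/t_{k-1})] when [t_k] is even, are linked by signs depending only on
    [t_{k-1}], [t_k] and [a_{k+1}] modulo 8, so the Jacobi sequence is the output
    of a finite automaton fed with the partial quotients modulo 8.

    For [e^2] these come from [coth 1 = [1; 3, 5, 7, ...]]: with
    [y_n = [2n+1; 2n+3, ...]] one has [e^2 = 2 y_1 + 1], and the complete quotients
    of [e^2] are Moebius transforms of the [y_n], which gives
    [e^2 = [7; (3k+2, 1, 1, 3k+3, 12k+18)_{k >= 0}]].  Modulo 8 this has period 40
    after [a_0], on which the denominators do not depend, and the automaton is
    back in its initial state after 40 steps. *)

Require Import Defs.
From HB Require Import structures.
From mathcomp Require Import all_boot all_order all_algebra.
From mathcomp Require Import all_fingroup all_solvable all_field.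
From mathcomp Require Import boolp classical_sets reals topology normedtype sequences exp.
From mathcomp Require Import zify ring lra.
Import Order.TTheory GRing.Theory Num.Theory.
Import numFieldNormedType.Exports.
Local Open Scope ring_scope.

(** * Quadratic reciprocity *)

(** Euler's criterion. Write [a] as a power [g ^ i] of a generator of the cyclic unit group: if the
    half-order power of [a] is 1, the order of [g] divides [i] times its own half, so [i] is even
    and [g ^ (i / 2)] is a root. *)
Lemma finField_square_expr (F : finFieldType) (a : F) : odd #|F| -> a != 0 ->
  a ^+ (#|F|)./2 = if [exists y : F, y ^+ 2 == a] then 1 else -1.
Proof.
move=> oF a0.
have cF1 : (#|F|.-1 = (#|F|)./2 * 2)%N by have := odd_double_half #|F|; rewrite oF; lia.
have unit1 (x : F) : x != 0 -> x ^+ (#|F|.-1) = 1.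
  move=> x0; apply: (mulfI x0); rewrite -exprS prednK ?mulr1 ?expf_card //.
  by apply/card_gt0P; exists x.
case: existsP => [[y /eqP ya]|nsq].
  rewrite -ya -exprM mulnC -cF1 unit1 //.
  by apply: contraNneq a0 => y0; rewrite -ya y0 expr0n.
have : (a ^+ (#|F|)./2) ^+ 2 == 1 by rewrite -exprM -cF1 unit1.
rewrite sqrf_eq1 => /orP[/eqP h1|/eqP//]; case: nsq.
have [g gen] := cyclicP (field_unit_group_cyclic [set: {unit F}]).
have ua : a \is a GRing.unit by rewrite unitfE.
have : FinRing.unit F ua \in <[g]>%g by rewrite -gen inE.
case/cycleP=> i hi.
have og : #[g]%g = #|F|.-1 by rewrite /order -gen card_finField_unit.
have h2 : (g ^+ (i * (#|F|)./2) == 1)%g.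
  rewrite expgM -hi; apply/eqP/val_inj.
  by rewrite FinRing.val_unitX /= h1.
rewrite -order_dvdn og cF1 mulnC in h2.
have i2 : (2 %| i)%N.
  have F1 : (1 < #|F|)%N := finNzRing_gt1 F.
  by rewrite dvdn_pmul2r // in h2; lia.
exists (val (g ^+ (i %/ 2))%g); apply/eqP.
by rewrite -FinRing.val_unitX -expgM divnK // -hi.
Qed.

Lemma legendre_modz (m : int) (p : nat) : legendre (m %% p)%Z p = legendre m p.
Proof. by rewrite /legendre modz_mod. Qed.

Lemma natr_Fp_eq0 (p n : nat) : prime p -> (n%:R == 0 :> 'F_p) = (p %| n)%N.
Proof. by move=> pp; rewrite (dvdn_pcharf (pchar_Fp pp)). Qed.

Lemma legendre_euler (m : int) (p : nat) : prime p -> odd p ->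
  (legendre m p)%:~R = (m%:~R : 'F_p) ^+ p./2.
Proof.
move=> pp op; have p3 : (2 < p)%N by rewrite odd_prime_gt2.
rewrite /legendre; set r := `|_|%N.
have mr : m%:~R = r%:R :> 'F_p.
  rewrite {1}(divz_eq m p) rmorphD rmorphM /= -[(p%:Z)%:~R]/(p%:R) pchar_Fp_0 //.
  rewrite mulr0 add0r -[r%:R]/(r%:~R) /r abszE ger0_norm // modz_ge0 //.
  lia.
have rp : (r < p)%N by rewrite /r; lia.
have : (r == 0)%N = (r%:R == 0 :> 'F_p).
  by rewrite natr_Fp_eq0 // /dvdn modn_small.
rewrite mr; case: eqP => [-> _|_ /esym/negbT r0].
  by rewrite expr0n; case: (p./2) (odd_double_half p) p3 => //; lia.
have := finField_square_expr 'F_p r%:R; rewrite card_Fp // => /(_ op r0) ->.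
suff -> : [exists y : 'F_p, y ^+ 2 == r%:R] = [exists x : 'I_p, (x * x %% p == r)%N].
  by case: ifP.
apply/existsP/existsP => [[y /eqP hy]|[x /eqP hx]].
  have hlt : (y < p)%N by have := ltn_ord y; rewrite [X in (_ < X)%N]Fp_cast.
  exists (Ordinal hlt) => /=.
  rewrite -[r](modn_small rp) -!val_Fp_nat // -hy natrM natr_Zp expr2.
  exact: eqxx.
exists (val x)%:R; rewrite expr2 -natrM -Fp_nat_mod // hx; exact: eqxx.
Qed.

Lemma legendre_val (m : int) (p : nat) :
  [|| legendre m p == 0, legendre m p == 1 | legendre m p == -1].
Proof. by rewrite /legendre; do 2?case: ifP. Qed.

(** Two such values differ by at most 2, which is less than [p]. Identities between symbols can
    therefore be proved in ['F_p] and lifted to integers. *)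
Lemma sign_Fp_inj (p : nat) (x y : int) : prime p -> odd p ->
  [|| x == 0, x == 1 | x == -1] -> [|| y == 0, y == 1 | y == -1] ->
  x%:~R = y%:~R :> 'F_p -> x = y.
Proof.
move=> pp op; have p3 : (2 < p)%N by rewrite odd_prime_gt2.
move=> hx hy /eqP; rewrite -subr_eq0 -rmorphB /= -(dvdz_pcharf (pchar_Fp pp)).
move/dvdzP => [k hk].
have [k0|/eqP k0] := eqVneq k 0; first by rewrite k0 mul0r in hk; lia.
have : p%:Z <= `|k * p%:Z|.
  by rewrite normrM ler_peMl //; lia.
by rewrite -hk; lia.
Qed.

Lemma legendreM (m n : int) (p : nat) : prime p -> odd p ->
  legendre (m * n) p = legendre m p * legendre n p.
Proof.
move=> pp op; apply: (sign_Fp_inj p) => //; first exact: legendre_val.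
  by case/or3P: (legendre_val m p) => /eqP->; case/or3P: (legendre_val n p) => /eqP->.
by rewrite rmorphM /= !legendre_euler // rmorphM exprMn.
Qed.

Lemma sign_val (e : nat) : [|| (-1) ^+ e == 0 :> int, (-1) ^+ e == 1 :> int | (-1) ^+ e == -1 :> int].
Proof. by rewrite -signr_odd; case: odd. Qed.

Lemma legendreN1 (p : nat) : prime p -> odd p -> legendre (-1) p = (-1) ^+ p./2.
Proof.
move=> pp op; apply: (sign_Fp_inj p) => //; first exact: legendre_val.
  exact: sign_val.
by rewrite legendre_euler // rmorphXn rmorphN.
Qed.

Lemma sum_ord_leq (c k : nat) : (c <= k)%N -> (\sum_(i < k) (i.+1 <= c) = c)%N.
Proof.
move=> ck; suff -> : (\sum_(i < k) (i.+1 <= c) = minn c k)%N by lia.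
by elim: k {ck} => [|k IH]; rewrite ?big_ord0 ?big_ord_recr /= ?IH; lia.
Qed.

(** No lattice point of Eisenstein's rectangle lies on the diagonal, since [p] cannot divide
    [j + 1 <= p / 2]. *)
Lemma coprime_muln_neq (p q i j : nat) : coprime p q -> (j < p./2)%N ->
  (q * j.+1 != p * i.+1)%N.
Proof.
move=> cpq jp; apply/eqP => e.
have : (p %| q * j.+1)%N by rewrite e dvdn_mulr.
by rewrite Gauss_dvdr // => /dvdn_leq; lia.
Qed.

(* Eisenstein's count of the lattice points below and above the diagonal. *)
Lemma eisenstein_lattice (p q : nat) : odd p -> odd q -> coprime p q ->
  (\sum_(j < p./2) (q * j.+1) %/ p + \sum_(i < q./2) (p * i.+1) %/ q
   = p./2 * q./2)%N.
Proof.
move=> op oq cpq.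
have F (m n : nat) : odd m -> odd n -> (\sum_(j < m./2) (n * j.+1) %/ m =
    \sum_(j < m./2) \sum_(i < n./2) (m * i.+1 <= n * j.+1))%N.
  move=> om on; apply: eq_bigr => -[c cm] _ /=.
  rewrite -[LHS](@sum_ord_leq _ n./2); last first.
    by rewrite -ltnS ltn_divLR; nia.
  by apply: eq_bigr => i _; rewrite leq_divRL 1?mulnC //; lia.
rewrite !F // [X in (_ + X)%N]exchange_big -big_split /=.
transitivity (\sum_(i < p./2) q./2)%N; last by rewrite sum_nat_const card_ord.
apply: eq_bigr => i _; rewrite -big_split /=.
rewrite (eq_bigr (fun=> 1%N)) ?sum_nat_const ?card_ord ?muln1 // => j _.
have := coprime_muln_neq p q j i cpq (ltn_ord i).
by case: ltngtP.
Qed.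

(** Gauss's lemma, with the number of residues above [p / 2] replaced by a number of the same
    parity. For odd [a] the even factor [a.+1] leaves only Eisenstein's floors; for [a = 2] the
    floors vanish instead. *)
Lemma gauss_lemma (p a : nat) : prime p -> odd p -> ~~ (p %| a)%N ->
  legendre a p = (-1) ^+ (\sum_(j < p./2) (a * j.+1) %/ p
                          + a.+1 * \sum_(j < p./2) j.+1).
Proof.
move=> pp op pa; have p3 : (2 < p)%N by rewrite odd_prime_gt2.
have hp := odd_double_half p; rewrite op -muln2 in hp.
set h := p./2 in hp *.
(* Modulo [p], [a * (j + 1)] is [g j] up to the sign recorded by [b j], with [g j] between 1 and
   [h]; [f] below is [g] shifted to start at 0. *)
pose r (j : 'I_h) := ((a * j.+1) %% p)%N.
pose b (j : 'I_h) := (h < r j)%N.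
pose g (j : 'I_h) := if b j then (p - r j)%N else r j.
have r0 j : (0 < r j)%N.
  rewrite lt0n -/(dvdn _ _) Euclid_dvdM // negb_or pa /=.
  by apply/negP => /dvdn_leq; have := ltn_ord j; lia.
have rp j : (r j < p)%N by rewrite ltn_mod; lia.
have gh j : ((g j).-1 < h)%N by have := r0 j; have := rp j; rewrite /g /b; case: (ltnP h); lia.
have g0 j : (0 < g j)%N by have := r0 j; have := rp j; rewrite /g; case: ifP; lia.
pose f j := Ordinal (gh j).
have fE j : (f j).+1 = g j by rewrite /= prednK.
have gF (j : 'I_h) : (a * j.+1)%:R = (-1) ^+ b j * (g j)%:R :> 'F_p.
  rewrite -Fp_nat_mod // -/(r j) /g; case: (b j); last by rewrite mul1r.
  by rewrite natrB ?(ltnW (rp j)) // pchar_Fp_0 // sub0r mulN1r opprK.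
have jF (j : 'I_h) : j.+1%:R != 0 :> 'F_p.
  by rewrite natr_Fp_eq0 //; apply/negP => /dvdn_leq; have := ltn_ord j; lia.
have aF : a%:R != 0 :> 'F_p by rewrite natr_Fp_eq0.
(* Equal [g] gives equal squares, so [j + 1] and [k + 1] agree up to sign; they cannot be opposite
   because their sum is less than [p]. *)
have finj : injective f.
  move=> j k fjk; have gjk : g j = g k by rewrite -!fE fjk.
  have : (a * j.+1)%:R ^+ 2 = (a * k.+1)%:R ^+ 2 :> 'F_p.
    by rewrite !gF !exprMn gjk !sqrr_sign.
  rewrite !natrM !exprMn => /(mulfI (expf_neq0 2 aF)) /eqP.
  rewrite eqf_sqr => /orP[].
    rewrite -!(inj_eq val_inj) /= !val_Fp_nat //.
    have := ltn_ord j; have := ltn_ord k => kh jh.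
    rewrite !modn_small; [|lia|lia].
    by move/eqP => [e]; apply: val_inj.
  rewrite -addr_eq0 -natrD natr_Fp_eq0 // => /dvdn_leq.
  by have := ltn_ord j; have := ltn_ord k; lia.
pose mu := (\sum_j b j)%N.
(* Multiply the congruences [gF] over all [j] and cancel [h!], which [f] only permutes. *)
have key : a%:R ^+ h = (-1) ^+ mu :> 'F_p.
  have P0 : \prod_(j < h) j.+1%:R != 0 :> 'F_p by apply/prodf_neq0.
  apply: (mulIf P0); rewrite [in RHS](reindex_inj finj) -prodrXr.
  transitivity (\prod_(j < h) (a * j.+1)%:R : 'F_p).
    under [RHS]eq_bigr do rewrite natrM.
    by rewrite big_split /= prodr_const card_ord.
  rewrite -big_split.
  by apply: eq_bigr => j _; rewrite fE gF.
(* Summing [a (j + 1) = p q_j + r_j], with [r_j] equal to [g j] or [p - g j], and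
   using that [f] permutes the indices; modulo 2 this determines [mu]. *)
have par : (a * (\sum_(j < h) j.+1) + 2 * \sum_j b j * g j
    = p * (\sum_(j < h) (a * j.+1) %/ p) + \sum_(j < h) j.+1 + p * mu)%N.
  rewrite [in X in (_ + X + _)%N](reindex_inj finj) /mu !big_distrr /= -!big_split /=.
  apply: eq_bigr => j _; rewrite prednK // {1}(divn_eq (a * j.+1) p) -/(r j) /g.
  by have := rp j; case: (b j); nia.
apply: (sign_Fp_inj p) => //; [exact: legendre_val|exact: sign_val|].
rewrite legendre_euler // -/h rmorphXn rmorphN rmorph1 /=.
rewrite -[(a%:Z)%:~R]/(a%:R) key -signr_odd -[RHS]signr_odd; congr (_ ^+ _).
move/(congr1 odd): par; rewrite !(oddD, oddM) op /= => par.
by congr nat_of_bool; move: par; do 4?case: odd.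
Qed.

Lemma legendre_reciprocity (p q : nat) : prime p -> odd p -> prime q -> odd q ->
  p != q -> legendre p q * legendre q p = (-1) ^+ (p./2 * q./2).
Proof.
move=> pp op pq oq pnq.
have cpq : coprime p q by rewrite prime_coprime // dvdn_prime2.
have qnp : q != p by rewrite eq_sym.
rewrite !gauss_lemma ?dvdn_prime2 //.
rewrite -exprD -eisenstein_lattice // -[LHS]signr_odd -[RHS]signr_odd.
by rewrite !(oddD, oddM) /= op oq /= !addbF addbC.
Qed.

Lemma legendre2 (p : nat) : prime p -> odd p ->
  legendre 2 p = (-1) ^+ ((p %% 8 == 3) || (p %% 8 == 5))%N.
Proof.
move=> pp op; have p3 : (2 < p)%N by rewrite odd_prime_gt2.
rewrite (@gauss_lemma p 2) //; last by apply/negP => /dvdn_leq; lia.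
rewrite big1 ?add0n; last first.
  by move=> j _; rewrite divn_small //; have := ltn_ord j; lia.
have -> : (\sum_(j < p./2) j.+1 = 'C(p./2.+1, 2))%N.
  by rewrite -bin2_sum big_mkord big_ord_recl.
rewrite -[LHS]signr_odd; congr (_ ^+ _); congr nat_of_bool.
have e := mul_bin_diag p./2.+1 1; rewrite bin1 in e.
have hp := odd_double_half p; rewrite op -muln2 in hp.
rewrite oddM /= in e *.
move: hp e; set h := p./2; set c := 'C(_, _) => hp e; clearbody c h.
(* As [p = 2h + 1], the residue of [p] modulo 8 is that of [h] modulo 4, and it fixes the parity of
   [h (h + 1) / 2]. *)
have := divn_eq h 4; set x := (h %/ 4)%N.
have : (h %% 4 < 4)%N by rewrite ltn_mod.
case: (h %% 4)%N => [|[|[|[|]]]] // _ hx.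
- have : (c = 2 * (x * (h.+1)))%N by nia.
  by move: (x * h.+1)%N => y; lia.
- have : (c = 2 * (x * (4 * x + 3)) + 1)%N by nia.
  by move: (x * _)%N => y; lia.
- have : (c = 2 * (x * (4 * x + 5)) + 3)%N by nia.
  by move: (x * (4 * x + 5))%N => y; lia.
- have : (c = 2 * ((4 * x + 3) * (x + 1)))%N by nia.
  by move: ((4 * x + 3) * _)%N => y; lia.
Qed.

(** * The Jacobi symbol *)

Definition jac (m : int) (n : nat) : int :=
  \prod_(p <- primes n) legendre m p ^+ logn p n.

(** The additional primes have exponent 0. This puts the symbols for [n1], [n2] and [n1 * n2] over
    one list of primes. *)
Lemma prod_primes_dvdn (F : nat -> int) (n N : nat) : (0 < N)%N -> (n %| N)%N ->
  \prod_(p <- primes n) F p ^+ logn p n = \prod_(p <- primes N) F p ^+ logn p n.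
Proof.
move=> N0 nN; have n0 : (0 < n)%N by exact: dvdn_gt0 nN.
rewrite [RHS](bigID (mem (primes n))) /= [X in _ * X]big1_seq ?mulr1; last first.
  move=> p /andP[/negbTE pn _]; suff -> : logn p n = 0%N by [].
  by rewrite lognE -mem_primes [p \in _]pn.
rewrite -[RHS]big_filter; apply: perm_big; apply: uniq_perm.
- exact: primes_uniq.
- by rewrite filter_uniq // primes_uniq.
move=> p; rewrite mem_filter /= [X in _ && X]mem_primes.
rewrite mem_primes n0 N0 /=; case: (prime p) => //=.
by case: (boolP (p %| n)%N) => //= pn; rewrite (dvdn_trans pn nN).
Qed.

Lemma jac1 m : jac m 1 = 1.
Proof. by rewrite /jac big_nil. Qed.

Lemma jac_prime m p : prime p -> jac m p = legendre m p.
Proof. by move=> pp; rewrite /jac primes_prime // big_seq1 logn_prime // eqxx. Qed.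

Lemma jacMr m n1 n2 : (0 < n1)%N -> (0 < n2)%N -> jac m (n1 * n2) = jac m n1 * jac m n2.
Proof.
move=> n10 n20; rewrite {2 3}/jac.
have n0 : (0 < n1 * n2)%N by rewrite muln_gt0 n10.
rewrite (@prod_primes_dvdn _ _ _ n0 (dvdn_mulr n2 (dvdnn n1))).
rewrite (@prod_primes_dvdn _ _ _ n0 (dvdn_mull n1 (dvdnn n2))).
rewrite -big_split; apply: eq_bigr => p _.
by rewrite lognM // exprD.
Qed.

Lemma odd_prime_ind (P : nat -> Prop) : P 1%N ->
  (forall p n, prime p -> odd p -> odd n -> P n -> P (p * n)%N) ->
  forall n, odd n -> P n.
Proof.
move=> P1 Pp n; elim/ltn_ind: n => n IH on.
have [n1|n1] := leqP n 1; first by have -> : n = 1%N by case: n n1 on {IH} => [|[|]].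
have := pdiv_dvd n; have := pdiv_prime n1; set p := pdiv n => pp pn.
have := on; rewrite -(divnK pn) mulnC oddM => /andP[op on'].
apply: Pp => //; apply: IH => //; rewrite ltn_Pdiv ?prime_gt1 //; lia.
Qed.

Lemma jac_modz (m : int) (n : nat) : jac (m %% n)%Z n = jac m n.
Proof.
rewrite /jac; apply: eq_big_seq => p; rewrite mem_primes => /and3P[_ _ pn].
case/dvdnP: pn => k nk; rewrite -legendre_modz -[in RHS]legendre_modz.
suff e : m = (m %/ n)%Z * k%:Z * p%:Z + (m %% n)%Z by rewrite [in RHS]e modzMDl.
by rewrite -mulrA -PoszM -nk -divz_eq.
Qed.

Lemma jacMl m m' n : odd n -> jac (m * m') n = jac m n * jac m' n.
Proof.
move=> on; rewrite /jac -big_split; apply: eq_big_seq => p.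
rewrite mem_primes => /and3P[pp _ pn]; rewrite legendreM ?exprMn //.
exact: dvdn_odd pn on.
Qed.

Lemma jac_sqr m n : odd n -> coprimez m n -> jac m n ^+ 2 = 1.
Proof.
move=> on; elim/odd_prime_ind: n / on => [|p n pp op on IH] c; first by rewrite jac1.
move: c; rewrite PoszM coprimezMr => /andP[c1 c2].
rewrite jacMr ?odd_gt0 //. rewrite exprMn IH // mulr1 jac_prime //.
have := legendre_val m p; case/or3P => /eqP h; rewrite h //.
have pm : (p%:Z %| m)%Z.
  move: h; rewrite /legendre; case: ifP => [/eqP r0 _|_]; last by case: ifP.
  by apply/dvdz_mod0P; lia.
by rewrite coprimez_sym coprimezE prime_coprime // -dvdzE pm in c1.
Qed.

Lemma sign_eq (x y : nat) : odd x = odd y -> (-1) ^+ x = (-1) ^+ y :> int.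
Proof. by move=> e; rewrite -signr_odd e signr_odd. Qed.

(** For odd [n], the sign with exponent [n./2] is the nontrivial character modulo 4, hence
    multiplicative. *)
Lemma oddM_half x y : odd x -> odd y -> odd (x * y)./2 = odd x./2 (+) odd y./2.
Proof.
move=> ox oy; have := odd_double_half x; have := odd_double_half y.
rewrite ox oy -!muln2; move: x./2 y./2 => {ox oy}a b <- <-.
rewrite (_ : _ * _ = 1 + (2 * (a * b) + a + b) * 2)%N; last by rewrite /nat_of_bool; lia.
by move: (a * b)%N => c; lia.
Qed.

Lemma jacN1 n : odd n -> jac (-1) n = (-1) ^+ n./2.
Proof.
elim/odd_prime_ind => [|p {}n pp op on IH]; first by rewrite jac1.
rewrite jacMr ?odd_gt0 // IH jac_prime // legendreN1 // -exprD.
by apply: sign_eq; rewrite oddD oddM_half.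
Qed.

Lemma jac2 n : odd n -> jac 2 n = (-1) ^+ ((n %% 8 == 3) || (n %% 8 == 5))%N.
Proof.
elim/odd_prime_ind => [|p {}n pp op on IH]; first by rewrite jac1.
rewrite jacMr ?odd_gt0 // IH jac_prime // legendre2 // -modnMm.
have : odd (p %% 8) by lia.
have : odd (n %% 8) by lia.
have : (p %% 8 < 8)%N by rewrite ltn_mod.
have : (n %% 8 < 8)%N by rewrite ltn_mod.
move: (p %% 8)%N (n %% 8)%N => x y.
by do 8?[case: x => [|x] //]; do 8?[case: y => [|y] //].
Qed.

Lemma jac1l n : jac 1 n = 1.
Proof.
rewrite /jac big1_seq // => p; rewrite mem_primes => /andP[_ /and3P[pp _ _]].
rewrite (_ : legendre 1 p = 1) ?expr1n // /legendre.
have p1 := prime_gt1 pp; rewrite modz_small ?ltz_nat //=.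
case: existsP => // -[]; exists (Ordinal p1) => /=.
by rewrite modn_small.
Qed.

(** Reciprocity is multiplicative in one argument and symmetric, so this serves the induction on
    either argument. *)
Lemma jac_reciprocityM (a b n : nat) : odd a -> odd b -> odd n ->
  jac a n * jac n a = (-1) ^+ (a./2 * n./2) ->
  jac b n * jac n b = (-1) ^+ (b./2 * n./2) ->
  jac (a * b)%N n * jac n (a * b) = (-1) ^+ ((a * b)./2 * n./2).
Proof.
move=> oa ob on ha hb.
rewrite PoszM jacMl // jacMr ?odd_gt0 // mulrACA ha hb -exprD.
by apply: sign_eq; rewrite !(oddD, oddM) oddM_half //; do 3?case: odd.
Qed.

Lemma jac_reciprocity (m n : nat) : odd m -> odd n -> coprime m n ->
  jac m n * jac n m = (-1) ^+ (m./2 * n./2).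
Proof.
move=> om; elim/odd_prime_ind: m / om n => [|p m pp op om IHm] n on.
  by rewrite jac1l jac1.
rewrite coprimeMl => /andP[cpn cmn]; apply: jac_reciprocityM => //; last exact: IHm.
rewrite mulrC [in RHS]mulnC.
elim/odd_prime_ind: n / on cpn {cmn} => [|q n pq oq on IHn]; first by rewrite jac1l jac1.
rewrite coprimeMr => /andP[cpq cpn]; apply: jac_reciprocityM => //; last exact: IHn.
rewrite !jac_prime // legendre_reciprocity //.
by apply: contraTneq cpq => ->; rewrite prime_coprime // dvdnn.
Qed.

(** * The automaton *)

(* Coprime [a] and [b] are not both even, so one of the two is a legitimate
   denominator. *)
Definition jsym (a b : nat) : int := if odd b then jac a b else jac b a.

Definition two_nonresidue (n : nat) : bool := ((n %% 8 == 3) || (n %% 8 == 5))%N.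

(* For [b = 2u] with [u] odd, the last factor is the reciprocity sign of
   [u] against [c * b + a] and [a], which differ modulo 4 exactly when [c] is odd. *)
Definition jflip (a b c : nat) : bool :=
  if odd b then ((b %% 4 == 3) && ((c * b + a) %% 4 == 3))%N
  else if (b %% 4 == 0)%N then false
  else two_nonresidue (c * b + a) (+) two_nonresidue a
       (+) ((b %% 8 == 6)%N && odd c).

Lemma jflip_mod8 a b c : jflip (a %% 8) (b %% 8) (c %% 8) = jflip a b c.
Proof.
have m4 n : (n %% 8 %% 4 = n %% 4)%N by lia.
have m8 : ((c %% 8 * (b %% 8) + a %% 8) %% 8 = (c * b + a) %% 8)%N.
  by rewrite -modnDml modnMm modnDm.
have o8 n : odd (n %% 8) = odd n by lia.
have m84 : ((c %% 8 * (b %% 8) + a %% 8) %% 4 = (c * b + a) %% 4)%N.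
  by rewrite -[LHS]m4 m8 m4.
by rewrite /jflip /two_nonresidue !o8 !m4 m84 m8 !modn_mod.
Qed.

Lemma odd_half_mod4 n : odd n -> odd n./2 = (n %% 4 == 3)%N.
Proof. lia. Qed.

Lemma jac_modn (m m' n : nat) : m = m' %[mod n] -> jac m n = jac m' n.
Proof. by move=> e; rewrite -jac_modz -[RHS]jac_modz !modz_nat e. Qed.

Lemma jac_flip (m n : nat) : odd m -> odd n -> coprime m n ->
  jac m n = (-1) ^+ (m./2 * n./2) * jac n m.
Proof.
move=> om on cmn; rewrite -jac_reciprocity // -mulrA -expr2 jac_sqr ?mulr1 //.
by rewrite coprimezE coprime_sym.
Qed.

(** Flip by reciprocity, reduce the numerator modulo [u], and flip back. *)
Lemma jac_denom_mod (u a n : nat) : odd u -> odd a -> odd n -> coprime u a ->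
  n = a %[mod u] -> jac u n = (-1) ^+ (u./2 * (a./2 + n./2)) * jac u a.
Proof.
move=> ou oa on cua nau.
have cun : coprime u n by rewrite -coprime_modr nau coprime_modr.
rewrite jac_flip // (jac_modn _ _ _ nau) (@jac_flip u a) // mulrA -exprD.
congr (_ * _); apply: sign_eq.
by rewrite !(oddD, oddM); do 3?case: odd.
Qed.

Lemma jac_expl (m : int) e n : odd n -> jac (m ^+ e) n = jac m n ^+ e.
Proof.
by move=> on; elim: e => [|e IH]; rewrite ?expr0 ?jac1l // !exprS jacMl // IH.
Qed.

(** The new denominator is congruent to [a] modulo [b]. For odd [b] a reduction suffices, preceded
    by a reciprocity flip if the new denominator is odd. For even [b], the power of 2 and the odd
    part of [b] are treated separately. *)
Lemma jsym_step (a b c : nat) : (0 < b)%N -> coprime a b ->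
  jsym b (c * b + a) = (-1) ^+ jflip a b c * jsym a b.
Proof.
move=> b0 cab; rewrite /jsym /jflip; set n := (c * b + a)%N.
have nab : n = a %[mod b] by rewrite /n modnMDl.
have cbn : coprime b n by rewrite -coprime_modr nab coprime_modr coprime_sym.
have [ob|eb] := ifPn (odd b).
  have [on|en] := ifPn (odd n); last first.
    rewrite (_ : _ && _ = false) ?mul1r; last by lia.
    exact: jac_modn.
  rewrite jac_flip // (jac_modn _ _ _ nab); congr (_ * _); apply: sign_eq.
  by rewrite oddM !odd_half_mod4 // oddb.
have oa : odd a by move: cab; rewrite (divn_eq b 2) modn2 (negbTE eb) addn0 coprimeMr coprimen2 => /andP[].
have on : odd n by rewrite oddD oddM (negbTE eb) andbF.
rewrite on; have [u cu ub] := pfactor_coprime (isT : prime 2) b0.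
set e := logn 2 b in ub; have ou : odd u by rewrite -coprime2n.
have cua : coprime u a by move: cab; rewrite ub coprime_sym coprimeMl => /andP[].
have nau : n = a %[mod u].
  by rewrite /n ub mulnCA -modnDml modnMr.
rewrite [in jac b n]ub [in jac b a]ub PoszM !jacMl // (jac_denom_mod _ _ _ ou oa on cua nau).
have jb x : odd x -> jac (2 ^ e)%N x = (-1) ^+ (e * two_nonresidue x).
  by move=> ox; rewrite -natz natrX jac_expl // jac2 // -exprM mulnC.
rewrite !jb //.
rewrite ![_ * (-1) ^+ (e * _)]mulrC !mulrA -!exprD; congr (_ * _); apply: sign_eq.
have := odd_half_mod4 _ on; have := odd_half_mod4 _ oa; have := odd_half_mod4 _ ou.
clearbody e; clear jb; case: e ub => [|[|e]] ub.
- by rewrite muln1 in ub; rewrite ub ou in eb.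
- have -> : (b %% 4 == 0)%N = false by lia.
  have -> : (b %% 8 == 6)%N = (u %% 4 == 3)%N by lia.
  have : (n %% 4 == 3)%N = (a %% 4 == 3)%N (+) odd c by rewrite /n ub; lia.
  rewrite !(oddD, oddM) !oddb => -> -> -> ->.
  by move: (u %% 4 == 3)%N (a %% 4 == 3)%N (odd c) (two_nonresidue n) (two_nonresidue a); do 5!case.
(* When 4 divides [b], [n] and [a] agree modulo 4 and the reciprocity signs cancel. The power of 2
   gives no sign either: its exponent is 2, or 8 divides [b] and [n] and [a] agree modulo 8. *)
- have e4 : (b = (u * 2 ^ e) * 4)%N by rewrite ub !expnS; lia.
  have -> : (b %% 4 == 0)%N by rewrite e4 modnMl.
  have -> : (n %% 4 == 3)%N = (a %% 4 == 3)%N by rewrite /n e4 mulnA modnMDl.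
  move=> hu ha hn; rewrite !(oddD, oddM) /= ha hn addbb andbF addbF.
  case: e ub e4 => [|e] ub e4 //.
  have -> : two_nonresidue n = two_nonresidue a.
    rewrite /two_nonresidue /n (_ : b = (u * 2 ^ e) * 8)%N ?mulnA ?modnMDl //.
    by rewrite ub !expnS; lia.
  by [].
Qed.

Definition jstep (st : nat * nat * bool) (c : nat) : nat * nat * bool :=
  let '(a, b, s) := st in (b, (c * b + a) %% 8, s (+) jflip a b c)%N.

(** The state holds the two latest denominators modulo 8 and the sign bit of their [jsym]. It starts
    from [t_{-1} = 0] and [t_0 = 1], so [c 0] is never read. *)
Fixpoint jstate (c : nat -> nat) (k : nat) : nat * nat * bool :=
  if k is k'.+1 then jstep (jstate c k') (c k %% 8)%N else (0, 1, false)%N.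

Fixpoint cf_denoms (c : nat -> nat) (k : nat) : nat * nat :=
  if k is k'.+1 then
    let: (a, b) := cf_denoms c k' in (b, c k * b + a)%N
  else (0, 1)%N.

Lemma cf_denoms_coprime c k : (forall i, 0 < c i.+1)%N ->
  let: (a, b) := cf_denoms c k in (0 < b)%N && coprime a b.
Proof.
move=> c0; elim: k => //= k; case: (cf_denoms c k) => a b /andP[b0 cab].
by rewrite addn_gt0 muln_gt0 c0 b0 /= -coprime_modr modnMDl coprime_modr coprime_sym.
Qed.

Lemma jstateP c k : (forall i, 0 < c i.+1)%N ->
  let: (a, b) := cf_denoms c k in exists2 s : bool,
    jstate c k = (a %% 8, b %% 8, s)%N & jsym a b = (-1) ^+ s.
Proof.
move=> c0; elim: k => [|k] /=; first by exists false; rewrite // /jsym jac1.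
have := cf_denoms_coprime c k c0; case: (cf_denoms c k) => a b /andP[b0 cab] [s -> hs].
exists (s (+) jflip a b (c k.+1)); last by rewrite jsym_step // hs -signr_addb addbC.
by rewrite /jstep jflip_mod8 -modnDml modnMm modnDm.
Qed.

(** The correction is the sign [(-1/t_k)^{k+1}], negative exactly for even [k] and [t_k] congruent
    to 3 modulo 4; [None] stands for the star. *)
Definition jout (k : nat) (st : nat * nat * bool) : option bool :=
  let '(a, b, s) := st in
  if odd b then Some (s (+) (~~ odd k && (b %% 4 == 3)%N)) else None.

Lemma cf_stE (R : realType) (x : R) (c : nat -> nat) :
  (forall k, cf_a x k = c k) -> forall k, exists s s' : int,
  let: (a, b) := cf_denoms c k in
  cf_st x k = ((s, b%:Z), (s', a%:Z)) /\ s * a%:Z - s' * b%:Z = (-1) ^+ k.+1.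
Proof.
move=> xc; elim=> [|k [s [s' IH]]].
  by exists (c 0%N), 1; split; [rewrite -(xc 0%N) | rewrite mulr0 mulr1 sub0r].
case E : (cf_denoms c k) IH => [a b] [IH1 IH2].
exists ((c k.+1)%:Z * s + s'), s; rewrite /= E PoszD PoszM; split.
  by rewrite IH1 -(xc k.+1).
by rewrite exprS -IH2; ring.
Qed.

Lemma jacobi_seqE (R : realType) (x : R) (c : nat -> nat) :
  (forall i, 0 < c i.+1)%N -> (forall k, cf_a x k = c k) ->
  forall k, jacobi_seq x k =
    if jout k (jstate c k) is Some s then JInt ((-1) ^+ s) else JStar.
Proof.
move=> c0 xc k; rewrite /jacobi_seq /cf_s /cf_t.
have [s [s']] := cf_stE _ x c xc k.
have := jstateP c k c0; have := cf_denoms_coprime c k c0.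
case: (cf_denoms c k) => a b /andP[b0 cab] [g -> hg] [-> det] /=.
have -> : odd (b %% 8) = odd b by lia.
rewrite /jacobi; case: ifP => // ob; congr JInt; rewrite -/(jac s b).
(* Modulo [b] the determinant identity reads [s * a = (-1) ^ (k + 1)]. *)
have jab : jac s b * jac a b = (-1) ^+ (b./2 * k.+1).
  rewrite -jacMl // exprM -jacN1 // -jac_expl // -det -[LHS]jac_modz -[RHS]jac_modz.
  by rewrite -mulNr addrC modzMDl.
move: hg; rewrite /jsym ob => hg.
rewrite -[LHS]mulr1 -[X in _ * X = _](jac_sqr a b) // expr2 mulrA jab hg -exprD.
apply: sign_eq; rewrite oddD oddM odd_half_mod4 // !oddb /=.
have -> : (b %% 8 %% 4 = b %% 4)%N by lia.
by rewrite addbC andbC.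
Qed.

(** * The continued fraction of e^2 *)

Section Bessel.
Local Open Scope classical_set_scope.
Local Open Scope ring_scope.
Variable R : realType.
Implicit Types n k K : nat.

(* [1 / (2^k k! (2(n+k)-1)!!)]: [blim n] is the modified spherical Bessel function
   [i_{n-1}(1)], with [blim 0 = cosh 1] and [blim 1 = sinh 1]. *)
Definition bterm n k : R := (2 ^+ k * k`!%:R * \prod_(i < n + k) (2 * i%:R + 1))^-1.

Definition bsum n K : R := \sum_(k < K) bterm n k.

Lemma odd_natr_gt0 n : 0 < 2 * n%:R + 1 :> R.
Proof. by rewrite ltr_wpDl // mulr_ge0. Qed.

Lemma bterm_gt0 n k : 0 < bterm n k.
Proof.
rewrite invr_gt0 mulr_gt0 ?mulr_gt0 ?exprn_gt0 ?ltr0n ?fact_gt0 //.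
by apply: prodr_gt0 => i _; exact: odd_natr_gt0.
Qed.

Lemma btermS n k : bterm n k.+1 = bterm n k / (2 * k.+1%:R * (2 * (n + k)%:R + 1)).
Proof.
rewrite /bterm addnS big_ord_recr /= factS natrM exprS -invfM; congr (_^-1).
by ring.
Qed.

Lemma btermSn n k : bterm n.+1 k = bterm n k / (2 * (n + k)%:R + 1).
Proof. by rewrite /bterm addSn big_ord_recr /= -invfM mulrA. Qed.

(** The three-term Bessel recurrence, exact for partial sums: the terms of index 0 cancel on the
    left, and those of index [k + 1] combine to [bterm n.+2 k]. *)
Lemma bsum_rec n K :
  bsum n K.+1 - (2 * n%:R + 1) * bsum n.+1 K.+1 = bsum n.+2 K.
Proof.
rewrite /bsum mulr_sumr -sumrB big_ord_recl /= btermSn addn0.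
have n0 := odd_natr_gt0 n; rewrite mulrC divfK ?gt_eqF // subrr add0r.
apply: eq_bigr => k _; rewrite /bump /= add1n !btermSn !btermS addSn addnS.
have := odd_natr_gt0 (n + k); have := odd_natr_gt0 (n + k).+1.
rewrite -[k.+1%:R]natr1 -[(n + k).+1%:R]natr1 natrD => h1 h2; have k0 : 0 < k%:R + 1 :> R by rewrite ltr_wpDl.
by field; rewrite !gt_eqF.
Qed.

(** Because [2^k k! (2k-1)!! = (2k)!], these are the Taylor terms of cosh and sinh at 1. *)
Lemma bterm01 k : bterm 0 k = ((k.*2)`!%:R)^-1 /\ bterm 1 k = ((k.*2).+1`!%:R)^-1.
Proof.
suff h : bterm 0 k = ((k.*2)`!%:R)^-1.
  split=> //; rewrite btermSn h factS natrM -invfM add0n mulrC; congr (_ * _)^-1.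
  by rewrite -[(k.*2).+1%:R]natr1 -mul2n natrM.
elim: k => [|k IH]; first by rewrite /bterm big_ord0 !mulr1.
rewrite btermS IH doubleS !factS !natrM -invfM; congr (_^-1).
by rewrite add0n -[(k.*2).+2%:R]natr1 -[(k.*2).+1%:R]natr1 -[k.+1%:R]natr1 -mul2n natrM; ring.
Qed.

Lemma series_exp1 K : series (exp_coeff (1 : R)) K.*2 = bsum 0 K + bsum 1 K /\
  series (exp_coeff (-1 : R)) K.*2 = bsum 0 K - bsum 1 K.
Proof.
elim: K => [|K [IH1 IH2]]; first by rewrite /series /= !big_geq // /bsum !big_ord0 subrr addr0.
rewrite /bsum !big_ord_recr -!/(bsum _ _) /=.
have [-> ->] := bterm01 K.
have S (u : nat -> R) m : series u m.+1 = series u m + u m by rewrite /series /= big_nat_recr.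
rewrite doubleS !S IH1 IH2.
rewrite /exp_coeff /= !expr1n exprS -signr_odd odd_double /= expr0.
by split; ring.
Qed.

Lemma cvg_double (u : nat -> R) (l : R) : u @ \oo --> l -> (fun K => u K.*2) @ \oo --> l.
Proof.
move=> ul; apply: (cvg_comp _ _ _ ul) => A [N _ NA]; exists N => // K /= NK.
by apply: NA => /=; lia.
Qed.

Lemma cvg_bsum01 :
  bsum 0 @ \oo --> (expR 1 + expR (-1)) / 2 /\ bsum 1 @ \oo --> (expR 1 - expR (-1)) / 2.
Proof.
have E (x : R) : (fun K => series (exp_coeff x) K.*2) @ \oo --> expR x.
  by apply: cvg_double; exact: is_cvg_series_exp_coeff.
split.
  have -> : bsum 0 = fun K => (series (exp_coeff 1) K.*2 + series (exp_coeff (-1)) K.*2) / 2.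
    by apply/funext => K; have [-> ->] := series_exp1 K; field.
  by apply: cvgMl; apply: cvgD; exact: E.
have -> : bsum 1 = fun K => (series (exp_coeff 1) K.*2 - series (exp_coeff (-1)) K.*2) / 2.
  by apply/funext => K; have [-> ->] := series_exp1 K; field.
by apply: cvgMl; apply: cvgB; exact: E.
Qed.

Definition blim n : R := limn (bsum n).

Lemma bsum_recS_cvg n (l l' : R) : bsum n @ \oo --> l -> bsum n.+1 @ \oo --> l' ->
  bsum n.+2 @ \oo --> l - (2 * n%:R + 1) * l'.
Proof.
move=> nl nl'.
have -> : bsum n.+2 = fun K => bsum n K.+1 - (2 * n%:R + 1) * bsum n.+1 K.+1.
  by apply/funext => K; rewrite bsum_rec.
by apply: cvgB; [|apply: cvgMr]; rewrite (cvg_shiftS _).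
Qed.

Lemma cvg_bsum n : bsum n @ \oo --> blim n.
Proof.
suff [] : cvgn (bsum n) /\ cvgn (bsum n.+1) by [].
have [c0 c1] := cvg_bsum01; elim: n => [|n [IH0 IH1]].
  by split; apply/cvg_ex; eexists; [exact: c0|exact: c1].
split=> //; apply/cvg_ex; eexists; exact: bsum_recS_cvg IH0 IH1.
Qed.

Lemma blim_rec n : blim n = (2 * n%:R + 1) * blim n.+1 + blim n.+2.
Proof.
have := bsum_recS_cvg _ _ _ (cvg_bsum n) (cvg_bsum n.+1).
by move/(cvg_lim (@norm_hausdorff _ _)); rewrite -/(blim n.+2) => ->; ring.
Qed.

Lemma blim_gt0 n : 0 < blim n.
Proof.
apply: lt_le_trans (bterm_gt0 n 0) _.
apply: limr_ge; first exact: cvg_bsum.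
near=> K; have K0 : (0 < K)%N by near: K; exists 1%N.
rewrite -(prednK K0) /bsum big_ord_recl lerDl.
by apply: sumr_ge0 => i _; rewrite ltW ?bterm_gt0.
Unshelve. all: by end_near. Qed.

(** This is [y_n = [2n+1; 2n+3, ...]]; in particular [bquot 0] is coth 1. *)
Definition bquot n : R := blim n / blim n.+1.

Lemma bquotE n : bquot n = 2 * n%:R + 1 + (bquot n.+1)^-1.
Proof.
have h1 := blim_gt0 n.+1; have h2 := blim_gt0 n.+2.
rewrite /bquot (blim_rec n) invf_div; field; by rewrite !gt_eqF.
Qed.

Lemma bquot_gt n : 2 * n%:R + 1 < bquot n.
Proof. by rewrite bquotE ltrDl invr_gt0 divr_gt0 ?blim_gt0. Qed.

(** The recurrence gives [blim 2 = cosh 1 - sinh 1 = exp(-1)], so [bquot 1 = sinh 1 / exp(-1) = (e^2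
    - 1) / 2]. *)
Lemma expR2_bquot : expR 2 = 2 * bquot 1 + 1.
Proof.
have [/(cvg_lim (@norm_hausdorff _ _)) e0 /(cvg_lim (@norm_hausdorff _ _)) e1] := cvg_bsum01.
rewrite -/(blim 0) in e0; rewrite -/(blim 1) in e1.
have := blim_rec 0; rewrite mulr0 add0r mul1r => /eqP.
rewrite addrC -subr_eq => /eqP e2.
have {e2} e2 : blim 2 = expR (-1) by rewrite -e2 e0 // e1 //; field.
rewrite /bquot e2 e1 // expRN (_ : expR 2 = expR 1 * expR 1); last by rewrite -expRD.
by field; rewrite gt_eqF ?expR_gt0.
Qed.

End Bessel.

(** * Partial quotients of e^2 *)

Lemma cf_step (R : realType) (x : R) (k a : nat) (z : R) : 1 < z ->
  cf_rest x k = a%:R + z^-1 -> cf_a x k = a /\ cf_rest x k.+1 = z.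
Proof.
move=> z1 e; have z0 : 0 < z by exact: lt_trans z1.
have fl : Num.floor (cf_rest x k) = a.
  apply: floor_def; rewrite e; apply/andP; split.
    by rewrite lerDl invr_ge0 ltW.
  by rewrite rmorphD /= ltrD2l invf_lt1.
by split=> //=; rewrite fl e addrC addKr invrK.
Qed.

Definition expR2_pq (i : nat) : nat :=
  if i is j.+1 then
    let k := (j %/ 5)%N in
    nth 0%N [:: 3 * k + 2; 1; 1; 3 * k + 3; 12 * k + 18]%N (j %% 5)
  else 7.

(** With [y_j] short for [y_{3k+j}], the complete quotients run through [y_2 / 2],
    [2 y_3 / (y_3 + 1)], [(y_3 + 1) / (y_3 - 1)], [(y_3 - 1) / 2], [2 y_4] and [y_5 / 2], where the
    next block begins. *)
Lemma cf_rest_expR2_block (R : realType) (k : nat) (x : R) :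
  cf_rest x (5 * k + 1) = bquot R (3 * k + 2) / 2 ->
  [/\ cf_a x (5 * k + 1) = (3 * k + 2)%N, cf_a x (5 * k + 2) = 1%N,
      cf_a x (5 * k + 3) = 1%N, cf_a x (5 * k + 4) = (3 * k + 3)%N &
      cf_a x (5 * k + 5) = (12 * k + 18)%N /\
      cf_rest x (5 * k.+1 + 1) = bquot R (3 * k.+1 + 2) / 2].
Proof.
have := bquotE R (3 * k + 2); have := bquotE R (3 * k + 3); have := bquotE R (3 * k + 4).
have := bquot_gt R (3 * k + 3); have := bquot_gt R (3 * k + 4); have := bquot_gt R (3 * k + 5).
rewrite -!addnS (_ : 3 * k.+1 + 2 = 3 * k + 5)%N; last by lia.
rewrite (_ : 5 * k.+1 + 1 = (5 * k + 5).+1)%N; last by lia.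
have E (i j : nat) : (i * k + j)%:R = i%:R * k%:R + j%:R :> R by rewrite natrD natrM.
rewrite !E.
move: (bquot R (3 * k + 5)) (bquot R (3 * k + 4)) (bquot R (3 * k + 3)) (bquot R (3 * k + 2)) => y5 y4 y3 y2 g5 g4 g3 e4 e3 e2.
have k0 : 0 <= k%:R :> R by [].
have z5 : 0 < y5 by lra.
have z4 : 0 < y4 by lra.
have z3 : 0 < y3 by lra.
have z31 : 0 < y3 - 1 by lra.
rewrite (addnS (5 * k) 4) (addnS (5 * k) 3) (addnS (5 * k) 2) (addnS (5 * k) 1) => h1.
move: (5 * k + 1)%N h1 => i h1.
have [a1 h2] : cf_a x i = (3 * k + 2)%N /\ cf_rest x i.+1 = 2 * y3 / (y3 + 1).
  apply: cf_step; first by rewrite ltr_pdivlMr; lra.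
  by rewrite h1 e2 E; field; rewrite !gt_eqF //; lra.
have [a2 h3] : cf_a x i.+1 = 1%N /\ cf_rest x i.+2 = (y3 + 1) / (y3 - 1).
  apply: cf_step; first by rewrite ltr_pdivlMr; lra.
  by rewrite h2; field; rewrite !gt_eqF //; lra.
have [a3 h4] : cf_a x i.+2 = 1%N /\ cf_rest x i.+3 = (y3 - 1) / 2.
  apply: cf_step; first lra.
  by rewrite h3; field; rewrite !gt_eqF //; lra.
have [a4 h5] : cf_a x i.+3 = (3 * k + 3)%N /\ cf_rest x i.+4 = 2 * y4.
  apply: cf_step; first lra.
  by rewrite h4 e3 E; field; rewrite !gt_eqF //; lra.
have [a5 h6] : cf_a x i.+4 = (12 * k + 18)%N /\ cf_rest x i.+4.+1 = y5 / 2.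
  apply: cf_step; first lra.
  by rewrite h5 e4 E; field; rewrite !gt_eqF //; lra.
by [].
Qed.

Lemma cf_a_expR2 (R : realType) (i : nat) : cf_a (expR (2 : R)) i = expR2_pq i.
Proof.
(* Here [e^2 = 2 y_1 + 1 = 7 + 2 / y_2]. *)
have [a0 h0] : cf_a (expR (2 : R)) 0 = 7%N /\ cf_rest (expR (2 : R)) 1 = bquot R 2 / 2.
  have g := bquot_gt R 2; apply: cf_step; first lra.
  by rewrite /= expR2_bquot bquotE; field; rewrite gt_eqF //; lra.
case: i => [//|j]; set x := expR 2 in h0 *.
have h k : cf_rest x (5 * k + 1) = bquot R (3 * k + 2) / 2.
  by elim: k => // k /cf_rest_expR2_block [_ _ _ _ []].
have [a1 a2 a3 a4 [a5 _]] := cf_rest_expR2_block _ _ _ (h (j %/ 5)%N).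
rewrite /expR2_pq {1}(divn_eq j 5) mulnC -addn1 -addnA.
have : (j %% 5 < 5)%N by rewrite ltn_mod.
by case: (j %% 5)%N => [|[|[|[|[|]]]]].
Qed.

(** * Period of the automaton on e^2 *)

Lemma expR2_pq_gt0 i : (0 < expR2_pq i.+1)%N.
Proof.
rewrite /expR2_pq; have : (i %% 5 < 5)%N by rewrite ltn_mod.
by case: (i %% 5)%N => [|[|[|[|[|]]]]] //= _; lia.
Qed.

(** Forty indices are eight blocks, which shift [k] by 8 in entries linear in [k]. Index 0 is
    excluded: [a_0 = 7], while [a_40 = 102] is 6 modulo 8. *)
Lemma expR2_pq_mod8 i : expR2_pq (i.+1 + 40) = expR2_pq i.+1 %[mod 8].
Proof.
rewrite addSn /expR2_pq (_ : i + 40 = 8 * 5 + i)%N; last by rewrite addnC.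
rewrite divnMDl // modnMDl; have : (i %% 5 < 5)%N by rewrite ltn_mod.
by move: (i %/ 5)%N => k; case: (i %% 5)%N => [|[|[|[|[|]]]]] //= _; lia.
Qed.

Lemma jstate_expR2_periodic k : jstate expR2_pq (k + 40) = jstate expR2_pq k.
Proof.
(* The base case runs the automaton for 40 steps, back to its initial state, sign bit included. *)
elim: k => [|k IH]; first by vm_compute.
have S j : jstate expR2_pq j.+1 = jstep (jstate expR2_pq j) (expR2_pq j.+1 %% 8) by [].
by rewrite addSn !S IH -addSn expR2_pq_mod8.
Qed.

Definition jout_expR2 (k : nat) : option bool := jout k (jstate expR2_pq k).

Lemma jout_expR2_mismatch :
  all (fun L => has (fun k => jout_expR2 (k + L) != jout_expR2 k) (iota 0 40))
      (iota 1 39).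
Proof. by vm_compute. Qed.

Theorem theorem6 (R : realType) :
  smallest_period (jacobi_seq (expR (2 : R))) 40.
Proof.
have E := jacobi_seqE R (expR 2) expR2_pq expR2_pq_gt0 (cf_a_expR2 R).
split=> [|L [L0 perL]].
  split=> // k; rewrite !E jstate_expR2_periodic.
  (* Besides the state, [jout] sees only the parity of [k], and 40 is even. *)
  by rewrite /jout oddD addbF.
rewrite leqNgt; apply/negP => L40.
have /(allP jout_expR2_mismatch) /hasP[k _ /eqP] : L \in iota 1 39.
  by rewrite mem_iota; lia.
apply; have := perL k; rewrite !E -!/(jout_expR2 _).
(* Distinct outputs give distinct symbols, so equal symbols contradict the computed mismatch. *)
by case: jout_expR2 => [s|]; case: jout_expR2 => [t|] //; case: s; case: t.
Qed.
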